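(* Let $L$ be a topological orthoalgebra and let $\mathcal{E}$ be its set of events with the Vietoris topology. If $L$ is stably ordered, then the canonical surjection $q:\mathcal{E}\to L$, $q(A)=\bigoplus A$, is open, and hence a quotient mapping.
   Context: An orthoalgebra is a structure $(L,\oplus,0,1)$ consisting of a set $L$, a partially-defined binary operation $\oplus$ on $L$, and two distinguished elements $0,1\in L$. The operation is commutative (if $a\oplus b$ is defined then so is $b\oplus a$ and they are equal) and associative in the strong sense (writing $a\perp b$ when $a\oplus b$ is defined: if $a\perp b$ and $(a\oplus b)\perp c$, then $b\perp c$, $a\perp (b\oplus c)$ and $(a\oplus b)\oplus c=a\oplus(b\oplus c)$). Moreover, for all $a\in L$: (a) $a\oplus 0=0\oplus a=a$; (b) there is a unique $a'\in L$ with $a\oplus a'=1$; (c) $a\oplus a$ exists only if $a=0$. An orthoalgebra is partially ordered by $a\le b$ iff there is $c\in L$ with $b=a\oplus c$. A topological orthoalgebra is an orthoalgebra equipped with a topology such that the relation $\perp\subseteq L\times L$ is closed and the mappings $\oplus:\perp\to L$ and ${}':L\to L$ are continuous. It is stably ordered if for every open $U\subseteq L$ the upper set $U\uparrow=\{b\in L\mid \exists a\in U,\ a\le b\}$ is open. For a finite set $A=\{a_1,\dots,a_n\}\subseteq L$, write $\bigoplus A=a_1\oplus\cdots\oplus a_n$ when this exists (with $\bigoplus\emptyset=0$). Let $X_L=L\setminus\{0\}$ with the subspace topology. The set $\mathcal{E}$ of events is the set of all finite subsets $A$ of $X_L$ for which $\bigoplus A$ exists (equivalently, all subsets of finite sets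 $E\subseteq X_L$ with $\bigoplus E=1$). For a topological space $X$, $2^X$ is the set of all closed subsets of $X$, with the Vietoris topology, generated by the sets $[U]=\{E\mid E\cap U\neq\emptyset\}$ and $(U)=\{E\mid E\subseteq U\}$, $U\subseteq X$ open. $\mathcal{E}$ is regarded as a subspace of $2^{X_L}$.
   Formalization: As stated it fails: the empty event is isolated in the Vietoris topology, so q open or quotient forces 0 to be isolated in L (false for 2^ℕ). Proved instead: q from nonempty events onto L∖{0} is open and a quotient map; and q on all events is so whenever 0 is isolated in L. *)

(* Defs.v *)
From HB Require Import structures.
From mathcomp Require Import all_boot finmap all_classical topology.

Set Implicit Arguments.
Unset Strict Implicit.
Unset Printing Implicit Defensive.

Local Open Scope classical_set_scope.

(* The partial operation is given by its domain [perp] and a total function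
   [oplus] whose values outside [perp] are irrelevant: no axiom below, and no
   later definition, looks at them. *)
HB.mixin Record isOrthoalgebra L & Choice L := {
  perp : L -> L -> Prop;
  oplus : L -> L -> L;
  ozero : L;
  oone : L;
  ocompl : L -> L;
  perp_sym : forall a b, perp a b -> perp b a;
  oplusC : forall a b, perp a b -> oplus a b = oplus b a;
  oplusA : forall a b c, perp a b -> perp (oplus a b) c ->
    [/\ perp b c, perp a (oplus b c)
      & oplus (oplus a b) c = oplus a (oplus b c)];
  perp0 : forall a, perp a ozero;
  oplus0 : forall a, oplus a ozero = a;
  perp_compl : forall a, perp a (ocompl a);
  oplus_compl : forall a, oplus a (ocompl a) = oone;
  ocompl_uniq : forall a b, perp a b -> oplus a b = oone -> b = ocompl a;
  perp_self : forall a, perp a a -> a = ozero;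
}.

#[short(type="orthoalgType")]
HB.structure Definition Orthoalgebra := {L of isOrthoalgebra L & Choice L}.

Arguments ozero {_}.
Arguments oone {_}.
Arguments perp_sym {_} [_ _].
Arguments oplusC {_} [_ _].
Arguments oplusA {_} [_ _ _].
Arguments ocompl_uniq {_} [_ _].
Arguments perp_self {_} [_].

HB.mixin Record Orthoalgebra_isTop L & Orthoalgebra L & Topological L := {
  perp_closed : closed [set p : L * L | perp p.1 p.2];
  oplus_continuous :
    {within [set p : L * L | perp p.1 p.2],
      continuous (fun p : L * L => oplus p.1 p.2)};
  ocompl_continuous : continuous (ocompl : L -> L);
}.

#[short(type="topOrthoalgType")]
HB.structure Definition TopOrthoalgebra :=
  {L of Orthoalgebra L & Topological L & Orthoalgebra_isTop L}.

Definition ole (L : orthoalgType) (a b : L) : Prop :=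
  exists2 c, perp a c & b = oplus a c.

Definition upper_set (L : orthoalgType) (U : set L) : set L :=
  [set b | exists2 a, U a & ole a b].

Definition stably_ordered (L : topOrthoalgType) : Prop :=
  forall U : set L, open U -> open (upper_set U).

Section Sums.
Variable L : orthoalgType.
Implicit Types (a b c x : L) (s t : seq L) (A : set L).

(* a_1 (+) (a_2 (+) (... (+) (a_n (+) 0))), or [None] if undefined. *)
Fixpoint oseq_sum s : option L :=
  if s is a :: s' then
    if oseq_sum s' is Some x then
      if `[< perp a x >] then Some (oplus a x) else None
    else None
  else Some ozero.

(* The sum of a finite set along its canonical enumeration; by
   [oseq_sum_perm] every other enumeration gives the same result. *)
Definition bigoplus A : option L := oseq_sum (fset_set A).

Lemma perp_symE a b : perp a b = perp b a.
Proof. by apply/propext; split; exact: perp_sym. Qed.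

Lemma oplus_perm_aux a b x : perp b x -> perp a (oplus b x) ->
  [/\ perp a x, perp b (oplus a x) & oplus a (oplus b x) = oplus b (oplus a x)].
Proof.
move=> bx abx.
have xb := perp_sym bx.
have xba : perp (oplus x b) a by rewrite oplusC //; exact: perp_sym.
have [ba xba' e1] := oplusA xb xba.
have ab := perp_sym ba.
have ax_b : perp (oplus a b) x by rewrite oplusC //; exact: perp_sym.
have bax : perp (oplus b a) x by rewrite -oplusC.
have [ax bax' e2] := oplusA ba bax.
have [_ _ e3] := oplusA ab ax_b.
by split => //; rewrite -e2 -e3 (oplusC ab).
Qed.

Lemma oseq_sum_swap a b s : oseq_sum [:: a, b & s] = oseq_sum [:: b, a & s].
Proof.
rewrite /=; case: (oseq_sum s) => [x|//].
have H c d : `[< perp c x >] -> `[< perp d (oplus c x) >] ->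
  [/\ `[< perp d x >], `[< perp c (oplus d x) >]
    & oplus d (oplus c x) = oplus c (oplus d x)].
  by move=> /asboolP cx /asboolP dcx; have [? ? ?] := oplus_perm_aux cx dcx;
    split => //; apply/asboolP.
case: (boolP `[< perp b x >]) => bx; case: (boolP `[< perp a x >]) => ax //.
- case: (boolP `[< perp a (oplus b x) >]) => abx.
    by have [_ -> ->] := H _ _ bx abx.
  case: (boolP `[< perp b (oplus a x) >]) => // bax.
  by have [_ h _] := H _ _ ax bax; rewrite h in abx.
- case: (boolP `[< perp a (oplus b x) >]) => // abx.
  by have [h _ _] := H _ _ bx abx; rewrite h in ax.
- case: (boolP `[< perp b (oplus a x) >]) => // bax.
  by have [h _ _] := H _ _ ax bax; rewrite h in bx.
Qed.

Lemma oseq_sum_rem a s : a \in s -> oseq_sum s = oseq_sum (a :: rem a s).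
Proof.
elim: s => //= b s ih; rewrite inE.
case: (eqVneq a b) => [-> //|_] /= as_.
have -> : oseq_sum s = oseq_sum (a :: rem a s) by exact: ih.
exact: (oseq_sum_swap b a (rem a s)).
Qed.

Lemma oseq_sum_perm s t : perm_eq s t -> oseq_sum s = oseq_sum t.
Proof.
elim: s t => [|a s ih] t st.
  by move: st; rewrite perm_sym => /perm_nilP ->.
have at_ : a \in t by rewrite -(perm_mem st) mem_head.
rewrite (oseq_sum_rem at_) /= (ih (rem a t)) //.
by rewrite -(perm_cons a); apply: (perm_trans st); exact: perm_to_rem.
Qed.

Lemma oplus_eq0 a b : perp a b -> oplus a b = ozero -> a = ozero.
Proof.
move=> ab e.
have h : perp (oplus a b) oone by rewrite e; apply: perp_sym; exact: perp0.
have [b1 _ _] := oplusA ab h.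
suff b0 : b = ozero by move: e; rewrite b0 oplus0.
apply: perp_self; move/perp_sym: b1; rewrite -(oplus_compl b) oplusC; last first.
  exact: perp_compl.
by move/(oplusA (perp_sym (perp_compl b))) => [].
Qed.

Lemma bigoplus_neq0 A x : finite_set A -> A !=set0 -> ~ A ozero ->
  bigoplus A = Some x -> x <> ozero.
Proof.
move=> fA [a Aa] A0; rewrite /bigoplus.
have : a \in enum_fset (fset_set A) by rewrite in_fset_set // inE.
have : ozero \notin enum_fset (fset_set A) by rewrite in_fset_set // notin_setE.
case: (enum_fset _) => // b s /=; rewrite inE negb_or => /andP[b0 _] _.
case: (oseq_sum s) => // y; case: asboolP => // bY [<-] /(oplus_eq0 bY) e.
by rewrite e eqxx in b0.
Qed.

End Sums.

Section Hyperspace.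
Variable X : topologicalType.

Record hyperspace := Hyperspace { hset :> set X; _ : closed hset }.

HB.instance Definition _ := gen_eqMixin hyperspace.
HB.instance Definition _ := gen_choiceMixin hyperspace.

Definition vietoris_hit (U : set X) : set hyperspace :=
  [set E : hyperspace | hset E `&` U !=set0].

Definition vietoris_sub (U : set X) : set hyperspace :=
  [set E : hyperspace | hset E `<=` U].

Definition vietoris_subbase : set (set hyperspace) :=
  [set W | exists2 U, open U & W = vietoris_hit U \/ W = vietoris_sub U].

HB.instance Definition _ :=
  isSubBaseTopological.Build hyperspace vietoris_subbase id.

End Hyperspace.

(* Sets are coerced to types by [set_type], whose topology is the subspace
   topology: [nonzero L] is X_L, and [events L] is a subspace of 2^(X_L). *)
Definition nonzero (L : orthoalgType) : set L := ~` [set ozero].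
Arguments nonzero : clear implicits.

Definition carrier (L : topOrthoalgType) (A : hyperspace (nonzero L)) : set L :=
  set_val @` hset A.

Definition events (L : topOrthoalgType) : set (hyperspace (nonzero L)) :=
  [set A | finite_set (hset A) /\ isSome (bigoplus (carrier A))].
Arguments events : clear implicits.

(* Being closed is no restriction on the finite sets in [events L]. *)
Lemma finite_closed (L : topOrthoalgType) (A : set (nonzero L)) :
  finite_set A -> closed A.
Proof.
move=> fA.
have ocomplK (a : L) : ocompl (ocompl a) = a.
  apply/esym/ocompl_uniq; first exact/perp_sym/perp_compl.
  by rewrite oplusC; [exact: oplus_compl | exact/perp_sym/perp_compl].
have leP (a b : L) : perp a (ocompl b) -> ole a b.
  move=> ab; have ba := perp_sym ab.
  have p := perp_compl (oplus (ocompl b) a).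
  have [ad bad e] := oplusA ba p.
  exists (ocompl (oplus (ocompl b) a)) => //.
  rewrite -[b in LHS]ocomplK; apply/esym/ocompl_uniq => //.
  by rewrite -e; exact: oplus_compl.
have le_anti (a b : L) : ole a b -> ole b a -> a = b.
  move=> [c ac ->] [d acd e]; have [cd a_cd e'] := oplusA ac acd.
  have p1 : perp (oplus a (oplus c d)) (ocompl a).
    by rewrite -e' -e; exact: perp_compl.
  have [pcd _ _] := oplusA a_cd p1.
  have p2 : perp (oplus (oplus c d) a) (ocompl a).
    by rewrite oplusC //; exact: perp_sym.
  have [_ q _] := oplusA (perp_sym a_cd) p2.
  have {}q : perp (oplus c d) oone by rewrite -(oplus_compl a).
  have cd0 : oplus c d = ozero.
    apply: perp_self; move/perp_sym: q; rewrite -(oplus_compl (oplus c d)).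
    rewrite oplusC; last exact: perp_compl.
    by move/(oplusA (perp_sym (perp_compl _))) => [].
  by rewrite (oplus_eq0 cd cd0) oplus0.
have cl1 (b : L) : closed [set b].
  pose P := [set p : L * L | perp p.1 p.2].
  have -> : [set b] = (fun a : L => (a, ocompl b)) @^-1` P
      `&` (fun a : L => (b, ocompl a)) @^-1` P.
    apply/seteqP; split => a /=.
      by move=> ->; split; exact: perp_compl.
    by move=> [/leP ? /leP ?]; exact: le_anti.
  apply: closedI; apply: preimage_closed; try exact: perp_closed.
  - by move=> a _; apply: cvg_pair; [exact: cvg_id|exact: cvg_cst].
  - move=> a _; apply: cvg_pair; first exact: cvg_cst.
    exact: ocompl_continuous.
have -> : A = set_val @^-1` (set_val @` A : set L).
  apply/seteqP; split => [x Ax|x [y Ay /val_inj <- //]]; by exists x.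
apply: preimage_closed; first by move=> x _; exact: initial_continuous.
rewrite -[X in closed X]bigcup_imset1.
exact: closed_bigcup.
Qed.

Definition event_sum (L : topOrthoalgType) (A : events L) : L :=
  odflt ozero (bigoplus (carrier (set_val A))).

(* [vietoris_sub set0] is the singleton of the empty event, which is therefore
   isolated in [events L]; its sum [ozero] need not be isolated in [L].  On the
   remaining events the sum takes its values in X_L. *)
Definition nonempty_events (L : topOrthoalgType) : set (events L) :=
  [set A : events L | hset (set_val A) !=set0].
Arguments nonempty_events : clear implicits.

Lemma nonempty_event_sum_neq0 (L : topOrthoalgType) (A : nonempty_events L) :
  event_sum (set_val A) \in nonzero L.
Proof.
case: A => [[A] evA neA]; rewrite inE /event_sum !set_valE /=.
have [fA sA] := set_mem evA; have [a Aa] := set_mem neA.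
case E: (bigoplus _) sA => [x|//] _ /=.
apply: (@bigoplus_neq0 _ (carrier A)) E; first exact: finite_image.
  by exists (set_val a); exists a.
by move=> [y _ y0]; exact: (set_valP y).
Qed.

Definition nonempty_event_sum (L : topOrthoalgType) (A : nonempty_events L) :
    nonzero L :=
  exist _ (event_sum (set_val A)) (nonempty_event_sum_neq0 A).

Definition open_map (X Y : topologicalType) (f : X -> Y) : Prop :=
  forall W : set X, open W -> open (f @` W).

Definition quotient_map (X Y : topologicalType) (f : X -> Y) : Prop :=
  set_surj setT setT f /\ (forall V : set Y, open V <-> open (f @^-1` V)).

(* Main.v *)
(* Openness.  If [L] is stably ordered then [oplus] is open: near [a (+) b], a
   point lies above some [x] close to [a], and its difference with [x] depends
   continuously on both, hence is close to [b].  By induction the set of all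
   defined sums [x_1 (+) ... (+) x_n] with [x_i] in prescribed open sets [U_i] is
   open for [n > 0].  A Vietoris neighborhood of [{a_1, ..., a_n}] contains all
   [{x_1, ..., x_n}] with [x_i] in suitable neighborhoods [U_i] of [a_i], and such
   [x_i] are automatically distinct once their sum exists, as orthogonal elements
   of [X_L] are distinct.

   Continuity.  An event in a small Vietoris neighborhood of [{a_1, ..., a_n}] has
   exactly one point near each [a_i]: two such points would be orthogonal, which
   passes to the limit as [a_i] orthogonal to [a_i]. *)
Require Import Defs.
From mathcomp Require Import all_boot finmap all_classical topology.

Set Implicit Arguments.
Unset Strict Implicit.
Unset Printing Implicit Defensive.

Local Open Scope classical_set_scope.

(** * Open quotients and finite separation in Hausdorff spaces *)

Section Topology.
Variables X Y : topologicalType.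

Lemma open_quotient (f : X -> Y) : set_surj setT setT f -> continuous f ->
  open_map f -> quotient_map f.
Proof.
move=> sf /continuousP cf fo; split=> // V; split; first exact: cf.
move=> /fo; congr open; apply/seteqP; split=> [_ [x Vx <-] //|y Vy].
by have [x _ fxy] := sf y I; exists x => //; rewrite /= fxy.
Qed.

(** Points are separated pairwise; since [s] is finite, intersecting over its members the sets
    chosen for [a] still gives a neighborhood of [a]. *)
Lemma hausdorff_family (s : seq X) : hausdorff_space X ->
  exists U : X -> set X, (forall a, nbhs a (U a)) /\
    {in s &, forall a b c, U a c -> U b c -> a = b}.
Proof.
rewrite open_hausdorff => hX.
have sep (p : X * X) : exists UV : set X * set X, p.1 <> p.2 ->
    [/\ nbhs p.1 UV.1, nbhs p.2 UV.2 & UV.1 `&` UV.2 = set0].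
  have [->|/hX[[U V] /= [Up Vp] [oU oV /eqP UV]]] := eqVneq p.1 p.2.
    by exists (setT, setT).
  by exists (U, V) => _; split=> //; apply: open_nbhs_nbhs; split=> //=;
    exact: set_mem.
have [F hF] := choice sep.
exists (fun a => \bigcap_(b in [set` [fset x in s]%fset])
  [set c | a <> b -> (F (a, b)).1 c /\ (F (b, a)).2 c]); split=> [a|].
  apply: filter_bigI => b _.
  have [->|/eqP ab] := eqVneq a b; first by apply: filterS filterT.
  have [h1 _ _] := hF (a, b) ab; have [_ h2 _] := hF (b, a) (nesym ab).
  by apply: filterS2 h1 h2 => c.
move=> a b sa sb c Ua Ub; apply: contrapT => ab.
have [_ _ dis] := hF (a, b) ab.
have [|h1 _] := Ua b _ ab; first by rewrite /= inE.
have [|_ h2] := Ub a _ (nesym ab); first by rewrite /= inE.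
by have : set0 c by rewrite -dis.
Qed.

End Topology.

(** * Neighborhoods of a closed set in the Vietoris topology *)

Section Vietoris.
Variable X : topologicalType.
Implicit Types (A B : hyperspace X) (U : X -> set X).

(** For finite [A] these sets form a neighborhood base at [A], by the next lemmas. *)
Definition follows A U : set (hyperspace X) :=
  [set B | (forall b, hset B b -> exists2 a, hset A a & U a b) /\
    (forall a, hset A a -> exists2 b, hset B b & U a b)].

Lemma vietoris_shrink A (W : set (hyperspace X)) : open W -> W A ->
  exists U, (forall a, hset A a -> nbhs a (U a)) /\ follows A U `<=` W.
Proof.
move=> oW WA.
have [S [Ssub SA SW]] : exists S : {fset set (hyperspace X)},
    [/\ {subset S <= @vietoris_subbase X}, forall i, i \in S -> i A
      & forall B, (forall i, i \in S -> i B) -> W B].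
  case: oW WA => D Dfin <- [W0 DW0 W0A]; have [S Ssub eW0] := Dfin _ DW0.
  exists S; split=> // [i iS|B SB]; first by move: W0A; rewrite -eW0; exact.
  by exists W0 => //; rewrite -eW0.
have step i : exists U, i \in S ->
    (forall a, hset A a -> nbhs a (U a)) /\ follows A U `<=` i.
  have [iS|_] := boolP (i \in S); last by exists (fun=> setT).
  have [O oO e] := set_mem (Ssub _ iS); have iA : i A by exact: SA.
  (* The same family serves both kinds of subbasic set: it confines to [O] only the points near an
     [a] in [O], which is some [a] for a hit set and every [a] for a containment set. *)
  exists (fun a => [set b | O a -> O b]) => _; split=> [a _|B [BA AB]].
    have [Oa|nOa] := pselect (O a); last by apply: filterS filterT => b _ /nOa.
    have : nbhs a O by exact: open_nbhs_nbhs.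
    by move=> nO; apply: (filterS _ nO) => b Ob _.
  case: e iA => -> /=.
    move=> [a [Aa Oa]]; have [b Bb Ob] := AB a Aa.
    by exists b; split=> //; exact: Ob.
  by move=> AO b /BA[a /AO Oa]; exact.
have [F hF] := choice step.
exists (fun a => \bigcap_(i in [set` S]) F i a); split=> [a Aa|B [BA AB]].
  by apply: filter_bigI => i /hF[+ _]; exact.
apply: SW => i Si.
have [_ FW] := hF i Si; apply: FW; split.
  by move=> b /BA[a Aa Uab]; exists a => //; exact: Uab.
by move=> a /AB[b Bb Uab]; exists b => //; exact: Uab.
Qed.

Lemma vietoris_subbase_open (V : set (hyperspace X)) :
  vietoris_subbase V -> open V.
Proof.
move=> Vs; exists [set V]; last by rewrite bigcup_set1.
move=> _ ->; exists [fset V]%fset; last by rewrite set_fset1 bigcap_set1.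
by move=> i /fset1P ->; rewrite inE.
Qed.

Lemma follows_nbhs A U : finite_set (hset A) -> (forall a, nbhs a (U a)) ->
  nbhs A (follows A U).
Proof.
move=> /finite_seqP[s As] nU.
pose V := \bigcup_(a in hset A) (U a)^°.
have Usub a : (U a)^° `<=` U a by exact: interior_subset.
have oV : open V by apply: bigcup_open => a _; exact: open_interior.
have nS : nbhs A (vietoris_sub V).
  apply: open_nbhs_nbhs; split.
    by apply: vietoris_subbase_open; exists V => //; right.
  by move=> a Aa; exists a => //; exact: nU.
have nH : nbhs A (\bigcap_(a in [set` [fset x in s]%fset]) vietoris_hit (U a)^°).
  apply: filter_bigI => a; rewrite inE /= => sa; apply: open_nbhs_nbhs; split.
    apply: vietoris_subbase_open; exists (U a)^°; last by left.
    exact: open_interior.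
  by exists a; split; [rewrite As | exact: nU].
apply: filterS2 nS nH => B BV BH; split=> [b /BV[a Aa /Usub Uab]|a].
  by exists a.
rewrite As /= => sa; have [|b [Bb /Usub Uab]] := BH a; first by rewrite /= inE.
by exists b.
Qed.

End Vietoris.

(** * Differences, order and orthogonality of summands *)

Section Orthoalgebra.
Variable L : orthoalgType.
Implicit Types (a b c x : L) (s : seq L).

Lemma ocomplK : involutive (@ocompl L).
Proof.
move=> a; apply/esym/ocompl_uniq; first exact/perp_sym/perp_compl.
by rewrite oplusC; [exact: oplus_compl | exact/perp_sym/perp_compl].
Qed.

(** This writes the difference of [oplus a c] and [a] through [ocompl] and [oplus] alone, so that it
    inherits their continuity. *)
Lemma oplus_subK a c : perp a c ->
  perp (ocompl (oplus a c)) a /\ ocompl (oplus (ocompl (oplus a c)) a) = c.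
Proof.
move=> ac; have ca := perp_sym ac.
have p : perp (oplus c a) (ocompl (oplus a c)).
  by rewrite (oplusC ca); exact: perp_compl.
have [ad cad e] := oplusA ca p; split; first exact: perp_sym.
rewrite -(oplusC ad); apply/esym/ocompl_uniq; first exact: perp_sym.
by rewrite (oplusC (perp_sym cad)) -e (oplusC ca) oplus_compl.
Qed.

Lemma perp_compl_le a b : perp a (ocompl b) -> ole a b.
Proof.
move=> ab; have ba := perp_sym ab.
have [ad bad e] := oplusA ba (perp_compl (oplus (ocompl b) a)).
exists (ocompl (oplus (ocompl b) a)) => //.
by rewrite -[b in LHS]ocomplK; apply/esym/ocompl_uniq; rewrite -?e ?oplus_compl.
Qed.

Lemma perp_oplusl a b c : perp b c -> perp a (oplus b c) -> perp a b.
Proof.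
move=> bc; rewrite (oplusC bc) => /perp_sym cba; apply: perp_sym.
by have [] := oplusA (perp_sym bc) cba.
Qed.

Lemma oplusI a b c : perp a b -> perp a c -> oplus a b = oplus a c -> b = c.
Proof.
by move=> /oplus_subK[_ eb] /oplus_subK[_ ec] e; rewrite -[RHS]ec -e eb.
Qed.

Lemma ole_anti a b : ole a b -> ole b a -> a = b.
Proof.
move=> [c ac ->] [d acd e]; have [cd a_cd e'] := oplusA ac acd.
have cd0 : oplus c d = ozero.
  by apply: oplusI a_cd (perp0 a) _; rewrite -e' -e oplus0.
by rewrite (oplus_eq0 cd cd0) oplus0.
Qed.

Lemma oseq_sum_cons a s x : oseq_sum (a :: s) = Some x <->
  exists y, [/\ oseq_sum s = Some y, perp a y & oplus a y = x].
Proof.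
split=> /= [|[y [-> ay <-]]]; last by case: asboolP.
by case: (oseq_sum s) => // y; case: asboolP => // ay [<-]; exists y.
Qed.

(** A repeated entry would be orthogonal to a sum containing it, hence to itself, and so would be
    zero. *)
Lemma oseq_sum_uniq s x : ozero \notin s -> oseq_sum s = Some x -> uniq s.
Proof.
elim: s x => // a s ih x; rewrite inE negb_or => /andP[a0 s0].
move=> /oseq_sum_cons[y [sy ay _]] /=; rewrite (ih _ s0 sy) andbT.
apply: contraNN a0 => sa; rewrite eq_sym.
move: sy; rewrite (oseq_sum_rem sa) => /oseq_sum_cons[z [_ az yE]].
by apply/eqP/perp_self; apply: perp_oplusl az _; rewrite yE.
Qed.

Lemma oseq_sum_perp s x a b : oseq_sum s = Some x -> a \in s -> b \in s ->
  a != b -> perp a b.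
Proof.
move=> sx sa sb ab; have sab : b \in rem a s.
  by move: sb; rewrite (perm_mem (perm_to_rem sa)) inE eq_sym (negbTE ab).
move: sx; rewrite (oseq_sum_rem sa) => /oseq_sum_cons[y [+ ay _]].
rewrite (oseq_sum_rem sab) => /oseq_sum_cons[z [_ bz yE]].
by apply: perp_oplusl bz _; rewrite yE.
Qed.

Lemma bigoplus_seq s : uniq s -> bigoplus [set` s] = oseq_sum s.
Proof.
move=> us; apply: oseq_sum_perm; apply: uniq_perm => //; first exact: fset_uniq.
move=> a; rewrite in_fset_set; last exact: finite_seq.
by apply/idP/idP; rewrite inE.
Qed.

Lemma bigoplus_map_val (s : seq (nonzero L)) : uniq s ->
  bigoplus (set_val @` [set` s]) = oseq_sum (map val s).
Proof.
move=> us; rewrite -bigoplus_seq; last by rewrite (map_inj_uniq val_inj).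
congr bigoplus; apply/seteqP; split=> [_ [b sb <-]|_ /mapP[b sb ->]].
  exact: map_f.
by exists b.
Qed.

End Orthoalgebra.

(** * Separation, and openness and continuity of finite sums *)

Section TopOrthoalgebra.
Variable L : topOrthoalgType.
Implicit Types x y : L.

Lemma nperp_near (a b : L) : ~ perp a b -> exists2 UV : set L * set L,
  nbhs a UV.1 /\ nbhs b UV.2 &
  forall x y, UV.1 x -> UV.2 y -> ~ perp x y.
Proof.
move=> nab; have := closed_openC (@perp_closed L).
rewrite openE => /(_ (a, b) nab) [UV nUV sub].
by exists UV => // x y Ux Vy; exact: (sub (x, y)).
Qed.

Lemma oplus_near (a b : L) O : perp a b -> nbhs (oplus a b) O ->
  exists2 UV : set L * set L, nbhs a UV.1 /\ nbhs b UV.2 &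
  forall x y, UV.1 x -> UV.2 y -> perp x y -> O (oplus x y).
Proof.
move=> ab nO; have /subspace_continuousP/(_ (a, b) ab) := @oplus_continuous L.
move=> /(_ O nO) [UV nUV sub].
by exists UV => // x y Ux Vy; exact: (sub (x, y)).
Qed.

(** If all neighborhoods of [a] and [b] meet, then [perp x (ocompl x)] at the common points passes
    to the limit, [perp] being closed. This gives [ole a b], and antisymmetry concludes. *)
Lemma orthoalg_hausdorff : hausdorff_space L.
Proof.
have half (a b : L) : cluster (nbhs a) b -> ole a b.
  move=> ab; apply: perp_compl_le; apply: contrapT => nab.
  have [[U V] /= [nU nV] UV] := nperp_near nab.
  have [x [Ux Vx]] := ab _ _ nU (ocompl_continuous _ _ nV).
  exact: UV Ux Vx (perp_compl x).
move=> a b ab; apply: ole_anti; apply: half => //.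
by move=> V U nV nU; rewrite setIC; exact: ab.
Qed.

Lemma nonzero_hausdorff : hausdorff_space (nonzero L).
Proof.
move=> a b ab; apply/val_inj/orthoalg_hausdorff => U V nU nV.
have nval (c : nonzero L) W : nbhs (val c) W -> nbhs c (val @^-1` W).
  exact: initial_continuous.
by have [c [Uc Vc]] := ab _ _ (nval _ _ nU) (nval _ _ nV); exists (val c).
Qed.

Lemma nonzero_open : open (nonzero L).
Proof.
apply: closed_openC; apply: accessible_closed_set1.
exact: hausdorff_accessible orthoalg_hausdorff.
Qed.

Lemma open_val (U : set (nonzero L)) : open U -> open (val @` U : set L).
Proof.
move=> [V oV <-].
have -> : val @` (val @^-1` V : set (nonzero L)) = V `&` nonzero L.
  apply/seteqP; split=> [_ [b Vb <-]|b [Vb b0]].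
    by split=> //; exact: set_valP.
  by exists (exist _ b (mem_set b0)).
by apply: openI => //; exact: nonzero_open.
Qed.

Lemma oplus_open (U V : set L) : stably_ordered L -> open U -> open V ->
  open [set c | exists a b, [/\ U a, V b, perp a b & oplus a b = c]].
Proof.
move=> hL oU oV; rewrite openE => _ [a [b [Ua Vb ab <-]]].
have [da dab] := oplus_subK ab.
have nV : nbhs (oplus (ocompl (oplus a b)) a) (ocompl @^-1` V).
  by apply: ocompl_continuous; rewrite dab; exact: open_nbhs_nbhs.
(* If [x] is in [M] and below [z], and [ocompl z] is in [N], then the difference of [z] and [x] is
   in [V]. *)
have [[N M] /= [nN nM] NM] := oplus_near da nV.
have nN' : nbhs (oplus a b) (ocompl @^-1` N) by exact: ocompl_continuous.
have nM' : nbhs (oplus a b) (upper_set (U `&` M^°)).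
  apply: open_nbhs_nbhs; split.
    by apply: hL; apply: openI => //; exact: open_interior.
  by exists a; [split | exists b].
apply: filterS2 nN' nM' => z Nz [x [Ux Mx] [y xy ez]].
move: Nz; rewrite {z}ez => Nz.
have [dx dxy] := oplus_subK xy; exists x, y; split=> //.
by rewrite -dxy; apply: NM => //; exact: interior_subset.
Qed.

(* A single summand ranges over an open set even if [ozero] is not isolated, so
   the last hypothesis matters for the empty sum only. *)
Lemma sums_open (V : nonzero L -> set (nonzero L)) (s : seq (nonzero L)) :
  stably_ordered L -> (forall a, open (V a)) -> uniq s ->
  s <> [::] \/ open [set ozero : L] ->
  open [set x | exists2 g : nonzero L -> nonzero L,
    forall a, a \in s -> V a (g a) & oseq_sum [seq val (g a) | a <- s] = Some x].
Proof.
move=> hL oV; elim: s => [_ [//|]|a s ih + h];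
  last rewrite cons_uniq => /andP[sa us].
  congr open; apply/seteqP; split=> [_ ->|x [g _ [<-]] //]; by exists id.
have [s0|/eqP s0] := eqVneq s [::].
  have := open_val (oV a); rewrite {}s0; congr open; apply/seteqP; split=> x.
    move=> [y Vy <-]; exists (fun=> y) => [b|]; first by rewrite inE => /eqP ->.
    by apply/oseq_sum_cons; exists ozero; split; rewrite ?oplus0 //; exact: perp0.
  move=> [g Vg /oseq_sum_cons[_ [[<-] _ <-]]].
  by rewrite oplus0; exists (g a) => //; apply: Vg; exact: mem_head.
have := oplus_open hL (open_val (oV a)) (ih us (or_introl s0)).
congr open; apply/seteqP; split=> x.
  move=> [_ [y [[b Vb <-] [g Vg gy] by_ <-]]].
  (* Redefining [g] at [a] leaves the tail unchanged, since [a] does not occur in [s]. *)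
  exists (fun c => if c == a then b else g c) => [c|].
    rewrite inE; case: eqVneq => [-> //|_ /=]; exact: Vg.
  apply/oseq_sum_cons; exists y; split; rewrite ?eqxx // -gy.
  congr oseq_sum; apply/eq_in_map => c sc.
  by case: eqVneq sa => // <-; rewrite sc.
move=> [g Vg /oseq_sum_cons[y [gy ay <-]]]; exists (val (g a)), y; split=> //.
  by exists (g a) => //; apply: Vg; exact: mem_head.
by exists g => // b sb; apply: Vg; rewrite inE sb orbT.
Qed.

(** Induction from the continuity of [oplus] on [perp]. Sums near a defined one may be undefined, so
    only defined ones are controlled. *)
Lemma sums_near (I : eqType) (v : I -> L) (s : seq I) x (O : set L) :
  oseq_sum (map v s) = Some x -> nbhs x O ->
  exists U : I -> set L, (forall i, nbhs (v i) (U i)) /\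
    forall g y, (forall i, i \in s -> U i (g i)) ->
      oseq_sum (map g s) = Some y -> O y.
Proof.
elim: s x O => [|i s ih] x O.
  move=> [<-] nO; exists (fun=> setT); split=> [i|g y _ [<-]].
    exact: filterT.
  exact: nbhs_singleton.
move=> /oseq_sum_cons[y [sy iy <-]] /(oplus_near iy)[[V W] /= [nV nW] VW].
have [U [nU UW]] := ih _ _ sy nW.
exists (fun j => [set z | U j z /\ (j = i -> V z)]); split=> [j|g z gU].
  apply: filterI; first exact: nU.
  have [->|/eqP ji] := eqVneq j i; first by apply: filterS nV.
  by apply: filterS filterT.
move=> /oseq_sum_cons[w [sw iw <-]]; apply: VW iw.
  by have [_] := gU i (mem_head _ _); exact.
by apply: UW sw => j sj; have [] := gU j; rewrite // inE sj orbT.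
Qed.

(** * Events as lists, and the sum map on them *)

Lemma event_enum (A : events L) : exists s : seq (nonzero L),
  [/\ uniq s, hset (val A) = [set` s]
    & oseq_sum (map val s) = Some (event_sum A)].
Proof.
have [fA] := set_valP A; rewrite /event_sum /carrier.
have [s0 As0] := (finite_seqP _).1 fA.
have As : hset (val A) = [set` undup s0].
  by rewrite As0; apply/seteqP; split=> a /=; rewrite mem_undup.
rewrite set_valE As bigoplus_map_val ?undup_uniq // => sA.
exists (undup s0); split=> //; first exact: undup_uniq.
by case: (oseq_sum _) sA.
Qed.

Lemma event_of_seq (s : seq (nonzero L)) x : oseq_sum (map val s) = Some x ->
  exists A : events L, hset (val A) = [set` s] /\ event_sum A = x.
Proof.
move=> sx; have us : uniq s.
  rewrite -(map_inj_uniq val_inj); apply: oseq_sum_uniq sx.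
  by apply/mapP => -[a _ e]; exact: (set_valP a).
have ev : Hyperspace (finite_closed (finite_seq s)) \in events L.
  rewrite inE; split; first exact: finite_seq.
  by rewrite /carrier /= bigoplus_map_val // sx.
exists (exist _ (Hyperspace _) ev); split=> //.
by rewrite /event_sum set_valE /carrier /= bigoplus_map_val // sx.
Qed.

(* Near an event [A], each [a] in [A] has a neighborhood containing no two
   orthogonal points, as [a] is not orthogonal to itself.  Once these
   neighborhoods are disjoint, a nearby event picks one point out of each. *)
Lemma event_sum_continuous : continuous (@event_sum L).
Proof.
move=> A O nO; have [s [us As sA]] := event_enum A.
have [S [nS Sdis]] := hausdorff_family s nonzero_hausdorff.
have [N [nN NO]] := sums_near sA nO.
have nperp (a : nonzero L) : exists U : set L, nbhs (val a) U /\
    forall x y, U x -> U y -> ~ perp x y.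
  have naa : ~ perp (val a) (val a) by move=> /perp_self; exact: (set_valP a).
  have [[U V] /= [nU nV] UV] := nperp_near naa.
  exists (U `&` V); split; first exact: filterI.
  by move=> x y [Ux _] [_ Vy]; exact: UV.
have [P hP] := choice nperp.
pose U (a : nonzero L) := S a `&` (val @^-1` (N a `&` P a)).
have nU a : nbhs a (U a).
  apply: filterI; first exact: nS.
  by apply: initial_continuous; apply: filterI; [exact: nN | exact: (hP a).1].
have nA : nbhs A (val @^-1` follows (val A) U).
  apply: initial_continuous; apply: follows_nbhs => //.
  by rewrite As; exact: finite_seq.
apply: (@filterS _ _ (nbhs_filter A) _ _ _ nA) => B [/= BA AB].
have [t [ut Bt tB]] := event_enum B.
have /choice[g hg] (a : nonzero L) : exists b, a \in s -> b \in t /\ U a b.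
  have [sa|_] := boolP (a \in s); last by exists a.
  have [|b Bb Uab] := AB a; first by rewrite As.
  by exists b => _; split=> //; rewrite Bt in Bb.
(* Distinct members of the event [B] are orthogonal, which [P a] forbids. *)
have Uinj a b : a \in s -> b \in t -> U a b -> b = g a.
  move=> sa tb [_ [_ Pb]]; have [tg [_ [_ Pg]]] := hg a sa.
  apply: contrapT => /eqP bg; apply: (hP a).2 Pb Pg _.
  by apply: (oseq_sum_perp tB) => //; exact: map_f.
have tE : perm_eq (map g s) t.
  apply: uniq_perm => //.
    rewrite map_inj_in_uniq // => a b sa sb e.
    have [_ [Sa _]] := hg a sa; have [_ [Sb _]] := hg b sb.
    by apply: Sdis sa sb _ Sa _; rewrite e.
  move=> b; apply/mapP/idP => [[a sa ->]|tb]; first by have [] := hg a sa.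
  have [|a Aa Uab] := BA b; first by rewrite Bt.
  by rewrite As in Aa; exists a => //; exact: Uinj.
apply: (NO (val \o g) _ _).
  by move=> a sa; have [_ [_ []]] := hg a sa.
by rewrite map_comp (oseq_sum_perm (perm_map _ tE)).
Qed.

Lemma event_sum_open (W : set (events L)) : stably_ordered L -> open W ->
  W `<=` nonempty_events L \/ open [set ozero : L] -> open (@event_sum L @` W).
Proof.
move=> hL [W0 oW0 <-] h; rewrite openE => _ [A WA <-].
have [s [us As sA]] := event_enum A.
have [U [nU UW]] := vietoris_shrink oW0 WA.
have s0 : s <> [::] \/ open [set ozero : L].
  case: h => [/(_ A WA)[a]|]; last by right.
  by rewrite As => sa; left => s0; rewrite s0 in sa.
have oS := sums_open hL (fun a => open_interior (U a)) us s0.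
apply: filterS (open_nbhs_nbhs (conj oS _)) => [x [g Ug]|]; last first.
  by exists id => // a sa; apply: nU; rewrite As.
rewrite (map_comp val g) => /event_of_seq[B [Bs <-]].
exists B => //; apply: UW; split=> [b|a].
  rewrite Bs => /mapP[a sa ->]; exists a; first by rewrite As.
  by apply: interior_subset; exact: Ug.
rewrite As => sa; exists (g a); first by rewrite Bs; exact: map_f.
by apply: interior_subset; exact: Ug.
Qed.

Lemma event_sum_surj : set_surj setT setT (@event_sum L).
Proof.
move=> x _; have [->|/eqP x0] := eqVneq x ozero.
  by have [A [_ <-]] := @event_of_seq [::] ozero erefl; exists A.
pose x' : nonzero L := exist _ x (mem_set x0).
have [|A [_ <-]] := @event_of_seq [:: x'] x; last by exists A.
by apply/oseq_sum_cons; exists ozero; split; rewrite ?oplus0 //; exact: perp0.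
Qed.

Lemma nonempty_event_sum_surj : set_surj setT setT (@nonempty_event_sum L).
Proof.
move=> x _; have [A _ Ax] := @event_sum_surj (val x) I.
have neA : A \in nonempty_events L.
  rewrite inE; have [[|a s] [_ As sA]] := event_enum A; last first.
    by exists a; rewrite As; exact: mem_head.
  by case: sA => e; case: (set_valP x); rewrite -Ax -e.
by exists (exist _ A neA) => //; apply: val_inj; rewrite /= set_valE.
Qed.

Lemma nonempty_events_open : open (nonempty_events L).
Proof.
exists (vietoris_hit setT); last by apply/seteqP; split=> A [a]; [case|]; exists a.
by apply: vietoris_subbase_open; exists setT => //; [exact: openT|left].
Qed.

End TopOrthoalgebra.

(** The empty event is isolated and has sum [ozero], so openness on all events forces [[set ozero]]
    to be open; without that, the statement concerns nonempty events and X_L. *)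
Theorem theorem4p5 (L : topOrthoalgType) (hL : stably_ordered L) :
  (open_map (@nonempty_event_sum L) /\ quotient_map (@nonempty_event_sum L)) /\
  (open [set ozero : L] ->
    open_map (@event_sum L) /\ quotient_map (@event_sum L)).
Proof.
have neo : open_map (@nonempty_event_sum L).
  move=> _ [W oW <-].
  (* Nonempty events form an open set, so [W] can be cut down to them and the image taken in [L]. *)
  exists (@event_sum L @` (W `&` nonempty_events L)).
    by apply: event_sum_open => //; [exact: openI oW (@nonempty_events_open L)|left].
  apply/seteqP; split=> [x [A [WA neA] Ax]|_ [A WA <-]].
    by exists (exist _ A (mem_set neA)) => //; apply: val_inj.
  by exists (val A) => //; split=> //; exact: set_valP.
have nec : continuous (@nonempty_event_sum L).
  apply/continuousP => _ [V oV <-].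
  exists (@event_sum L @^-1` V) => //.
  by have /continuousP ec := @event_sum_continuous L; apply: ec.
split.
  by split=> //; apply: open_quotient => //; exact: nonempty_event_sum_surj.
move=> o0; have eo : open_map (@event_sum L).
  by move=> W oW; apply: event_sum_open => //; right.
split=> //; apply: open_quotient => //; first exact: event_sum_surj.
exact: event_sum_continuous.
Qed.
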